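(* Let $\Delta$ be a simplicial complex and let $k\in\mathbb{N}$ (so $k\ge1$). Suppose there exists an $\ell$-simplex $\sigma$ of $\Delta$ such that $\Delta$ is flag with respect to $\sigma$, and such that every vertex $v$ of $\Delta$ is joinable to some $(\ell-k)$-face of $\sigma$. Then $\Delta$ is $\left(\left\lfloor\frac{\ell}{k}\right\rfloor-1\right)$-connected.
   Context: Two simplices $\rho_1,\rho_2$ of a simplicial complex $\Delta$ are joinable to each other if they lie in a common simplex of $\Delta$. For a fixed simplex $\sigma$ in $\Delta$, $\Delta$ is called flag with respect to $\sigma$ if whenever $\rho$ is a simplex of $\Delta$ and $\sigma'$ is a face of $\sigma$ such that every vertex of $\rho$ is joinable to every vertex of $\sigma'$, then $\rho$ is joinable to $\sigma'$. ($\Delta$ is not assumed finite or flag.) A face of negative dimension is understood to be the empty face, which is joinable to everything. $(-1)$-connected means non-empty. *)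

(* Defs.v *)
From HB Require Import structures.
From mathcomp Require Import all_boot all_order all_algebra finmap.
From mathcomp Require Import boolp classical_sets functions set_interval reals.
From mathcomp Require Import topology normedtype.

Set Implicit Arguments.
Unset Strict Implicit.
Unset Printing Implicit Defensive.

Import Order.TTheory GRing.Theory Num.Theory.
Import numFieldNormedType.Exports.

Local Open Scope classical_set_scope.
Local Open Scope fset_scope.
Local Open Scope ring_scope.

(* The empty face is always counted among the faces, so that "face of negative
   dimension" makes sense. Elements of [V] need not all be vertices: [v] is a
   vertex when [fset1 v] is a face. *)
Record simplicial_complex (V : choiceType) := SimplicialComplex {
  faces : set {fset V};
  faces0 : faces fset0;
  faces_sub : forall s t : {fset V}, t `<=` s -> faces s -> faces t
}.

Section SimplicialComplex.
Variables (V : choiceType) (D : simplicial_complex V).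
Implicit Types (s t r : {fset V}) (v w : V).

Definition vertex v : Prop := faces D [fset v].

Definition simplex (l : nat) s : Prop := faces D s /\ #|` s| = l.+1.

Definition joinable r t : Prop :=
  exists s : {fset V}, [/\ faces D s, r `<=` s & t `<=` s].

(* Every face of negative dimension is the empty one. *)
Definition face_of_dim (d : int) t s : Prop :=
  t `<=` s /\ (if 0 <= d then (#|` t|%:Z = d + 1)%R else t = fset0).

Definition flag_wrt s : Prop :=
  forall r t, faces D r -> t `<=` s ->
    (forall v w, v \in r -> w \in t -> joinable [fset v] [fset w]) ->
    joinable r t.

End SimplicialComplex.

Section Realization.
Variables (R : realType) (V : choiceType) (D : simplicial_complex V).

Definition supported_on (s : {fset V}) (x : V -> R) : Prop :=
  forall v, v \notin s -> x v = 0.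

Record realization := Realization {
  bary :> V -> R;
  bary_ge0 : forall v, 0 <= bary v;
  bary_sum1 : exists s : {fset V},
    [/\ faces D s, supported_on s bary & \sum_(v <- s) bary v = 1]
}.

HB.instance Definition _ := gen_eqMixin realization.
HB.instance Definition _ := gen_choiceMixin realization.

(* The weak (coherent) topology: [U] is open iff its trace on each closed
   simplex is open for the Euclidean topology, given here by the sup-distance
   of barycentric coordinates. *)
Definition realization_open : set_system realization := fun U =>
  forall s, faces D s -> forall x : realization, U x -> supported_on s x ->
    exists2 e : R, 0 < e & forall y : realization, supported_on s y ->
      (forall v, `|x v - y v| < e) -> U y.

Let realization_openT : realization_open setT.
Proof. by move=> s _ x _ _; exists 1. Qed.

Let realization_openI : setI_closed realization_open.
Proof.
move=> A B oA oB s Ds x [Ax Bx] sx.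
have [e e0 eA] := oA s Ds x Ax sx; have [d d0 dB] := oB s Ds x Bx sx.
exists (Num.min e d); first by rewrite lt_min e0.
move=> y sy xy; split; [apply: eA => // v | apply: dB => // v];
  by have := xy v; rewrite lt_min => /andP[].
Qed.

Let realization_open_bigU (I : Type) (F : I -> set realization) :
  (forall i, realization_open (F i)) -> realization_open (\bigcup_i F i).
Proof.
move=> oF s Ds x [i _ Fx] sx; have [e e0 eF] := oF i s Ds x Fx sx.
by exists e => // y sy xy; exists i => //; apply: eF.
Qed.

HB.instance Definition _ := isOpenTopological.Build realization
  realization_openT realization_openI realization_open_bigU.

Lemma realization_openE : @open realization = realization_open.
Proof. by []. Qed.

End Realization.

Section Connectivity.
Variables (R : realType) (X : topologicalType).

Definition cube (i : nat) : set 'rV[R]_i :=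
  [set p | forall j, 0 <= p ord0 j <= 1].

Definition cube_boundary (i : nat) : set 'rV[R]_i :=
  [set p | cube p /\ exists j, p ord0 j = 0 \/ p ord0 j = 1].

(* Maps of pairs (I^i, boundary of I^i) -> (X, x0): the representatives of
   the elements of pi_i(X, x0). Only the values on the cube matter. *)
Definition spheroid (i : nat) (x0 : X) (f : 'rV[R]_i -> X) : Prop :=
  {within @cube i, continuous f} /\ (forall p, cube_boundary p -> f p = x0).

Definition spheroid_homotopic (i : nat) (x0 : X) (f g : 'rV[R]_i -> X) : Prop :=
  exists H : 'rV[R]_i * R -> X,
    [/\ {within (@cube i `*` `[0, 1])%classic, continuous H},
        forall p, cube p -> H (p, 0) = f p,
        forall p, cube p -> H (p, 1) = g p &
        forall p t, cube_boundary p -> 0 <= t <= 1 -> H (p, t) = x0].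

Definition homotopy_group_trivial (i : nat) (x0 : X) : Prop :=
  forall f : 'rV[R]_i -> X,
    spheroid x0 f -> spheroid_homotopic x0 f (fun=> x0).

(* Nonempty (as soon as n >= -1), with pi_i(X, x0) trivial for all x0 and all
   i <= n; every space is n-connected for n < -1. *)
Definition n_connected (n : int) : Prop :=
  (-1 <= n -> exists x : X, True) /\
  (forall i : nat, i%:Z <= n -> forall x0 : X, homotopy_group_trivial i x0).

End Connectivity.

(* Main.v *)
Require Import Defs.
From mathcomp Require Import all_boot all_order all_algebra finmap.
From mathcomp Require Import boolp classical_sets functions cardinality.
From mathcomp Require Import set_interval reals interval_inference topology normedtype.
From mathcomp Require Import zify ring lra.
Import Order.TTheory GRing.Theory Num.Theory.
Import numFieldNormedType.Exports.
Set Implicit Arguments.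
Unset Strict Implicit.
Unset Printing Implicit Defensive.
Local Open Scope ring_scope.

(* Let [f] be a spheroid of dimension [i] with [(i + 1) k <= l]. Since the cube
   is compact, [f] only meets finitely many vertices. The cube is covered by
   [i + 1] families of disjoint small open bricks (translates of one fine grid),
   and each brick can be labelled by a vertex [v] whose coordinate [f_v] is
   positive on it. Normalized bump functions of the bricks, summed over equal
   labels, are barycentric coordinates [m_v] with [m_v > 0] only where [f_v > 0],
   at most [i + 1] of them being nonzero at any point. Each vertex is joinable to all but at most
   [k] of the [l + 1] vertices of [s], so at every point some vertex of [s] is
   joinable to all the labels used there, and flagness gives an explicit homotopy
   from [f] through [m] to the barycentre of [s]. On the boundary of the cube this
   homotopy depends on time only, so it can be made relative to the base point. *)

(** * The weak topology of the realization and compact sets in it *)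

Section RealizationTopology.
Local Open Scope classical_set_scope.
Local Open Scope fset_scope.
Local Open Scope ring_scope.
Variables (R : realType) (V : choiceType) (D : simplicial_complex V).
Local Notation X := (realization R D).

Lemma realization_ext (x y : X) : (forall v, x v = y v) -> x = y.
Proof.
case: x => x x0 x1; case: y => y y0 y1 /= /funext xy.
move: y0 y1; rewrite -xy => y0 y1; congr Realization; exact: Prop_irrelevance.
Qed.

(** Some chosen face supporting [x], not necessarily the smallest: coordinates of [x] may vanish on
    it. *)
Definition carrier (x : X) : {fset V} := sval (cid (bary_sum1 x)).

Lemma carrierP (x : X) : [/\ faces D (carrier x), supported_on (carrier x) x &
  \sum_(v <- carrier x) x v = 1].
Proof. exact: svalP (cid (bary_sum1 x)). Qed.

Definition affine_fun (c : V -> R) (x : X) : R :=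
  \sum_(v <- carrier x) c v * x v.

Lemma affine_funE c s (x : X) : supported_on s x ->
  affine_fun c x = \sum_(v <- s) c v * x v.
Proof.
move=> sx; have [_ cx _] := carrierP x.
rewrite /affine_fun (@big_fset_incl _ _ _ _ _ (carrier x `|` s)) ?fsubsetUl//.
  rewrite [RHS](@big_fset_incl _ _ _ _ _ (carrier x `|` s)) ?fsubsetUr//.
  by move=> v _ /sx ->; rewrite mulr0.
by move=> v _ /cx ->; rewrite mulr0.
Qed.

Lemma sum_supported s (x : X) : supported_on s x -> \sum_(v <- s) x v = 1.
Proof.
move=> sx; have [_ cx <-] := carrierP x; symmetry.
have := affine_funE (fun=> 1) sx; rewrite (affine_funE _ cx).
by under eq_bigr do rewrite mul1r; under [RHS]eq_bigr do rewrite mul1r.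
Qed.

(** In the weak topology continuity is tested on one closed simplex at a time. There only finitely
    many coefficients occur and the function is Lipschitz, even when [c] is unbounded on [V]. *)
Lemma affine_fun_continuous c : continuous (affine_fun c).
Proof.
apply/continuousP => A oA; rewrite realization_openE => s Ds x Ax sx.
have /nbhs_ballP[e /= e0 eA] : nbhs (affine_fun c x) A by apply: open_nbhs_nbhs.
(* The summand [1] keeps [M] positive and makes the final estimate strict. *)
pose M := 1 + \sum_(v <- s) `|c v|.
have M0 : 0 < M by rewrite ltr_wpDr// sumr_ge0.
exists (e / M); first by rewrite divr_gt0.
move=> y sy xy; apply: eA; rewrite /ball/= (affine_funE _ sx) (affine_funE _ sy).
rewrite -sumrB; apply: (le_lt_trans (ler_norm_sum _ _ _)).
apply: (@le_lt_trans _ _ (\sum_(v <- s) `|c v| * (e / M))).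
  by apply: ler_sum => v _; rewrite -mulrBr normrM ler_wpM2l// ltW.
rewrite -mulr_suml mulrCA gtr_pMr// ltr_pdivrMr// mul1r /M.
by rewrite ltrDr.
Qed.

Lemma coord_realization_continuous v : continuous (fun x : X => x v).
Proof.
have -> : (fun x : X => x v) = affine_fun (fun w => (w == v)%:R).
  apply/funext => x; have [_ cx _] := carrierP x.
  rewrite (@affine_funE _ (v |` carrier x)); last first.
    by move=> w; rewrite !inE negb_or => /andP[_]; exact: cx.
  rewrite (bigD1_seq v) ?fset_uniq ?fset1U1//= eqxx mul1r big1 ?addr0// => w wv.
  by rewrite (negbTE wv) mul0r.
exact: affine_fun_continuous.
Qed.

(* Otherwise pick distinct [v_n] and points [x_n] of the image with
   [x_n v_n > 0]: the function with weight [n / x_n v_n] at [v_n] is continuous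
   and unbounded on the image. *)
Lemma compact_supported (Q : topologicalType) (A : set Q) (f : Q -> X) :
  compact A -> {within A, continuous f} ->
  exists T : {fset V}, forall q, A q -> supported_on T (f q).
Proof.
move=> cA cf; pose W := [set v | exists2 q, A q & f q v != 0].
have [fW|/infiniteP/card_leP[h0]] := pselect (finite_set W).
  exists (fset_set W) => q Aq v; rewrite in_fset_set// => /negP vW.
  by apply/eqP/negPn/negP => fqv; apply: vW; rewrite inE; exists q.
pose h n := set_val (h0 (to_setT n)).
have hI n m : h n = h m -> n = m.
  by move=> /val_inj e; have /(congr1 set_val) := 'inj_h0 (mem_setT _) (mem_setT _) e.
have hW n : exists q, A q /\ f q (h n) != 0.
  by have /set_mem[q Aq fq] := valP (h0 (to_setT n)); exists q.
pose q n := sval (cid (hW n)).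
have qP n : A (q n) /\ f (q n) (h n) != 0 by exact: svalP (cid (hW n)).
(* By injectivity of [h] the chosen index is the only one; off the range of [h] the weight is
   [0]. *)
pose c v := if pselect (exists n, h n = v) is left e
  then let n := sval (cid e) in n%:R / f (q n) (h n) else 0.
have ch n : c (h n) = n%:R / f (q n) (h n).
  rewrite /c; case: pselect => [e|[]]; last by exists n.
  by have := svalP (cid e) => /= /hI ->.
have c0 v : 0 <= c v.
  rewrite /c; case: pselect => // e; rewrite divr_ge0//; exact: bary_ge0.
have : compact ((affine_fun c \o f) @` A).
  apply: continuous_compact => //; apply: within_continuous_comp => // x _.
  exact: affine_fun_continuous.
move=> /compact_bounded [M [_ /(_ (M + 1))]]; rewrite ltrDl ltr01 => /(_ isT) bM.
pose n := Num.bound `|M + 1|.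
have [Aq fq] := qP n.
have /bM/= : ((affine_fun c \o f) @` A)%classic (affine_fun c (f (q n))).
  by exists (q n).
rewrite leNgt => /negP[].
have [_ cx _] := carrierP (f (q n)).
have hc : h n \in carrier (f (q n)) by apply: contraNT fq => /cx ->.
have : n%:R <= affine_fun c (f (q n)).
  rewrite /affine_fun (bigD1_seq (h n)) ?fset_uniq//= ch divfK// lerDl.
  by apply: sumr_ge0 => v _; rewrite mulr_ge0// bary_ge0.
move=> hn; apply: lt_le_trans (ler_norm _); apply: lt_le_trans hn.
exact: le_lt_trans (ler_norm _) (archi_boundP _).
Qed.

(** The finite set [T] has finitely many subsets, so one neighbourhood of [q] can serve all the
    faces inside [T] at once. [T] itself need not be a face. *)
Lemma realization_map_continuous (Q : topologicalType) (T : {fset V})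
    (g : Q -> X) :
  (forall q, supported_on T (g q)) ->
  (forall v, continuous (fun q => g q v)) -> continuous g.
Proof.
move=> gT cg q A; rewrite nbhsE => -[B [oB Bq] BA].
have gB s : s \in fpowerset T ->
    \forall q' \near q, faces D s -> supported_on s (g q') -> B (g q').
  move=> _; have [Ds|nDs] := pselect (faces D s); last by near=> q'.
  have [sq|/existsNP[v /not_implyP[vs /eqP gv]]] := pselect (supported_on s (g q)).
    rewrite realization_openE in oB; have [e e0 eB] := oB s Ds _ Bq sq.
    have : \forall q' \near q, (\bigcap_(v in [set` T])
        [set q' | `|g q v - g q' v| < e]) q'.
      by apply: filter_bigI => v _; move/cvgrPdist_lt: (cg v q); exact.
    apply: filterS => q' gq' _ sq'; apply: eB => // v.
    have [vT|vT] := boolP (v \in T); first exact: gq'.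
    by rewrite !gT// subrr normr0.
  (* A nonzero coordinate outside [s] stays nonzero nearby, so no [g q'] near [q] is supported on
     [s]. *)
  have /cvgr_neq0/(_ gv) := cg v q.
  by apply: filterS => q' /eqP gv' _ /(_ v vs).
have := filter_bigI (nbhs_filter q) gB; apply: filterS => q' /= Bq'; apply: BA.
have [Dc cx _] := carrierP (g q').
apply: (Bq' (T `&` carrier (g q'))) => //=.
- by rewrite fpowersetE fsubsetIl.
- by apply: faces_sub Dc; rewrite fsubsetIr.
- by move=> v; rewrite inE negb_and => /orP[/gT->//|/cx->].
Unshelve. all: by end_near. Qed.

End RealizationTopology.

(** * Continuity of finite sums and positive parts *)

Section RealFunctions.
Local Open Scope classical_set_scope.
Local Open Scope ring_scope.

Lemma sum_continuous (R : realType) (Q : topologicalType) (I : Type)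
    (r : seq I) (P : pred I) (F : I -> Q -> R) :
  (forall i, P i -> continuous (F i)) ->
  continuous (fun q => \sum_(i <- r | P i) F i q).
Proof.
by move=> cF; apply: continuous_big => //; exact: add_continuous.
Qed.

Lemma cvg_max0 (R : realType) (T : Type) (F : set_system T) (f : T -> R)
    (l : R) : Filter F ->
  f x @[x --> F] --> l -> Num.max 0 (f x) @[x --> F] --> Num.max 0 l.
Proof.
move=> FF fl; apply: (cvg_comp f (Num.max 0) fl).
apply: (@continuous_max _ _ (fun=> 0) id); [exact: cvg_cst|exact: cvg_id].
Qed.

End RealFunctions.

(** * The explicit homotopy to the barycentre of [s] *)

Section StraightToCone.
Local Open Scope classical_set_scope.
Local Open Scope fset_scope.
Local Open Scope ring_scope.
Variables (R : realType) (V : choiceType) (D : simplicial_complex V).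
Local Notation X := (realization R D).

Lemma realization_gt0 (x : X) : exists v, 0 < x v.
Proof.
have [_ _ s1] := carrierP x; apply: contrapT => /forallNP x0.
move/eqP: s1; rewrite big1 1?eq_sym ?oner_eq0// => v _.
by apply/eqP; rewrite eq_le bary_ge0 andbT leNgt; apply/negP.
Qed.

(** Division by the total weight makes barycentric coordinates out of [y]. The supporting face may
    jump with [q]; only the finite set [T] is uniform, and this suffices for continuity. *)
Lemma normalized_map (Q : topologicalType) (T : {fset V}) (y : Q -> V -> R) :
  (forall q v, 0 <= y q v) ->
  (forall q, exists2 r, faces D r & supported_on r (y q)) ->
  (forall q, supported_on T (y q)) ->
  (forall q, exists v, 0 < y q v) ->
  (forall v, continuous (y^~ v)) ->
  exists2 g : Q -> X, continuous g &
    forall q v, g q v = y q v / \sum_(u <- T) y q u.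
Proof.
move=> y0 yD yT ygt0 cy; pose S q := \sum_(u <- T) y q u.
have S0 q : 0 < S q.
  have [v yv] := ygt0 q; have vT : v \in T.
    by apply: contraTT yv => /yT ->; rewrite ltxx.
  by rewrite /S (bigD1_seq v) ?fset_uniq//= ltr_wpDr// sumr_ge0.
have gE q : exists x : X, forall v, x v = y q v / S q.
  have ge0 v : 0 <= y q v / S q by rewrite divr_ge0// ltW.
  suff sum1 : exists r : {fset V}, [/\ faces D r,
      supported_on r (fun v => y q v / S q) & \sum_(v <- r) y q v / S q = 1].
    by exists (Realization ge0 sum1).
  (* Both [r] and [T] support [y q], so summing over their intersection gives the same total as
     summing over [T]. *)
  have [r Dr yr] := yD q; exists (r `&` T); split.
  - by apply: faces_sub Dr; rewrite fsubsetIl.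
  - move=> v; rewrite inE negb_and => /orP[/yr|/yT] ->; by rewrite mul0r.
  - rewrite -mulr_suml (@big_fset_incl _ _ _ _ _ T) ?fsubsetIr//.
      by apply: divff; rewrite gt_eqF ?S0.
    by move=> v vT; rewrite inE vT andbT => /yr.
exists (fun q => sval (cid (gE q))); last by move=> q v; case: cid.
have gyE q v : sval (cid (gE q)) v = y q v / S q by case: cid.
apply: (@realization_map_continuous _ _ _ _ T) => [q v vT|v].
  by rewrite gyE yT// mul0r.
rewrite (_ : (fun q => _) = fun q => y q v / S q); last by apply/funext.
move=> q; apply: cvgM; first exact: cy.
apply: cvgV; first by rewrite gt_eqF.
by apply: sum_continuous => u _; exact: cy.
Qed.

Variables (s T : {fset V}).

(** A continuous measure of the failure of joinability: for nonnegative [m] it vanishes exactly when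
    every vertex of [T] of positive weight is joinable to [w]. *)
Definition unjoined (m : V -> R) (w : V) : R :=
  \sum_(u <- T | ~~ `[< joinable D [fset u] [fset w] >]) m u.

(* For [t <= 1/2] this is the segment from [x] to [m]. For [t >= 1/2] it lowers
   the coordinates of [m] and adds a vertex [w] of [s] only when every
   surviving vertex is joinable to [w]; at [t = 1] only [s] is left. *)
Definition to_cone (x m : V -> R) (t : R) (v : V) : R :=
  let a := Num.max 0 (1 - 2 * t) in
  let c := Num.max 0 (2 * t - 1) in
  let b := 1 - `|2 * t - 1| in
  a * x v + Num.max 0 (b * m v - c) +
  (v \in s)%:R * Num.max 0 (c - b * unjoined m v).

(** The pointwise conditions making [to_cone] normalizable to a point of the realization. The
    weights [m] need not sum to [1], since [cone_coord] normalizes afterwards. *)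
Definition subordinate (x m : V -> R) : Prop :=
  [/\ supported_on T x, forall v, 0 <= m v, forall v, m v != 0 -> x v != 0,
      exists v, 0 < m v &
      exists2 w, w \in s &
        forall u, m u != 0 -> joinable D [fset u] [fset w]].

Lemma unjoined_ge0 (m : V -> R) w : (forall v, 0 <= m v) -> 0 <= unjoined m w.
Proof. by move=> m0; apply: sumr_ge0. Qed.

Lemma to_cone0 x m v : to_cone x m 0 v = x v.
Proof.
have a1 : Num.max 0 (1 - 2 * 0) = 1 :> R by rewrite max_r; lra.
have c0 : Num.max 0 (2 * 0 - 1) = 0 :> R by rewrite max_l; lra.
have b0 : 1 - `|2 * 0 - 1| = 0 :> R by rewrite mulr0 sub0r normrN1 subrr.
by rewrite /to_cone a1 c0 b0 !mul0r subrr maxxx mulr0 mul1r !addr0.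
Qed.

Lemma to_cone1 x m v : to_cone x m 1 v = (v \in s)%:R.
Proof.
have a0 : Num.max 0 (1 - 2 * 1) = 0 :> R by rewrite max_l; lra.
have c1 : Num.max 0 (2 * 1 - 1) = 1 :> R by rewrite max_r; lra.
have b0 : 1 - `|2 * 1 - 1| = 0 :> R.
  by rewrite (_ : 2 * 1 - 1 = 1) ?normr1 ?subrr//; lra.
rewrite /to_cone a0 c1 b0 !mul0r add0r max_l ?add0r; last by lra.
by rewrite max_r ?mulr1 ?subr0//; lra.
Qed.

Lemma to_cone_ge0 (x : X) m t v : 0 <= to_cone x m t v.
Proof.
rewrite /to_cone !addr_ge0 ?mulr_ge0 ?le_max ?lexx ?bary_ge0//.
Qed.

Lemma to_cone_supported (x : X) m t : 0 <= t <= 1 -> subordinate x m ->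
  supported_on (T `|` s) (to_cone x m t).
Proof.
move=> t01 [xT m0 mx _ _] v; rewrite inE negb_or => /andP[vT vs].
rewrite /to_cone (negbTE vs) mul0r addr0 xT// mulr0 add0r.
have -> : m v = 0 by apply/eqP/negPn/negP => /mx; rewrite xT ?eqxx.
by rewrite mulr0 sub0r max_l// oppr_le0 le_max lexx.
Qed.

(** The positive coordinate comes from [x] before time [1/2], from the common neighbour [w] after
    it, and from [m] at [1/2], where the two other terms vanish. *)
Lemma to_cone_gt0 (x : X) m t : 0 <= t <= 1 -> subordinate x m ->
  exists v, 0 < to_cone x m t v.
Proof.
move=> t01 [xT m0 mx [v mv] [w ws mw]].
have [tlt|tgt|t2] := ltgtP (2 * t) 1.
- have [u xu] := realization_gt0 x; exists u.
  rewrite /to_cone -addrA ltr_wpDr//.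
    by rewrite addr_ge0// ?mulr_ge0 ?le_max ?lexx.
  by rewrite mulr_gt0// lt_max subr_gt0 tlt orbT.
- exists w; rewrite /to_cone ws mul1r ltr_wpDl//.
    by rewrite addr_ge0 ?mulr_ge0 ?le_max ?lexx ?bary_ge0.
  have -> : unjoined m w = 0.
    rewrite /unjoined big1// => u /asboolPn uw; apply/eqP/negPn/negP => /mw.
    exact.
  by rewrite mulr0 subr0 !lt_max subr_gt0 tgt !orbT.
- exists v; rewrite /to_cone t2 subrr normr0 maxxx mul0r add0r !subr0 mul1r.
  by rewrite ltr_wpDr ?mulr_ge0 ?lt_max ?mv ?orbT// le_max lexx.
Qed.

(** Up to time [1/2] everything lives on the carrier of [x]. Afterwards let [v] survive, so
    [c < b * m v], and let [w] be present, so [b * unjoined m w < c]. If they were not joinable,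
    [m v] would be a term of [unjoined m w], a contradiction; flagness then joins all of [r] to all
    of [s']. *)
Lemma to_cone_face (x : X) m t : flag_wrt D s -> 0 <= t <= 1 ->
  subordinate x m -> exists2 r, faces D r & supported_on r (to_cone x m t).
Proof.
move=> fl t01 [xT m0 mx _ _]; have [Dx cx _] := carrierP x.
have b0 : 0 <= 1 - `|2 * t - 1| by rewrite subr_ge0 ler_norml; lra.
have mc v : v \notin carrier x -> m v = 0.
  by move=> /cx xv; apply: contra_eq xv => /mx.
have [tle|tgt] := leP (2 * t) 1.
  have c0 : Num.max 0 (2 * t - 1) = 0 by rewrite max_l// subr_le0.
  exists (carrier x) => // v /[dup] /mc mv /cx xv.
  rewrite /to_cone xv mv !mulr0 add0r c0 subrr maxxx add0r sub0r max_l ?mulr0//.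
  by rewrite oppr_le0 mulr_ge0// unjoined_ge0.
have a0 : Num.max 0 (1 - 2 * t) = 0 by rewrite max_l// subr_le0 ltW.
set b := 1 - _ in b0; pose c := Num.max 0 (2 * t - 1).
pose r := [fset v in T | c < b * m v]; pose s' := [fset w in s | b * unjoined m w < c].
have c0 : 0 <= c by rewrite le_max lexx.
have rcx : r `<=` carrier x.
  apply/fsubsetP => v; rewrite !inE/= => /andP[_]; apply: contraTT => /mc ->.
  by rewrite mulr0 -leNgt.
have [|||r' [Dr' rr' s'r']] := fl r s'.
- exact: faces_sub Dx.
- exact: fset_sub.
- move=> v w; rewrite !inE/= => /andP[vT cv] /andP[ws cw].
  apply: contrapT => nvw; move: (lt_trans cw cv); apply/negP; rewrite -leNgt.
  rewrite ler_wpM2l// /unjoined big_mkcond (bigD1_seq v) ?fset_uniq//=.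
  by rewrite asboolF//= lerDl sumr_ge0// => u _; case: ifP.
exists r' => // v vr'; rewrite /to_cone a0 mul0r add0r -/b -/c.
have -> : Num.max 0 (b * m v - c) = 0.
  rewrite max_l// subr_le0 leNgt; apply: contra vr' => cv.
  apply: (fsubsetP rr'); rewrite !inE cv andbT/=.
  apply: contraTT cv => vT; rewrite -leNgt.
  suff -> : m v = 0 by rewrite mulr0.
  by apply/eqP/negPn/negP => /mx; rewrite xT ?eqxx.
rewrite add0r; case: (boolP (v \in s)) => vs; rewrite ?mul0r// mul1r.
rewrite max_l// subr_le0 leNgt; apply: contra vr' => cv.
by apply: (fsubsetP s'r'); rewrite !inE vs.
Qed.

Definition cone_coord x m t v : R :=
  to_cone x m t v / \sum_(u <- T `|` s) to_cone x m t u.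

Lemma cone_coord0 (x : X) m v : subordinate x m -> cone_coord x m 0 v = x v.
Proof.
move=> xm; rewrite /cone_coord to_cone0.
under eq_bigr do rewrite to_cone0.
rewrite sum_supported ?divr1// => u; rewrite inE negb_or => /andP[uT _].
by case: xm => xT _ _ _ _; exact: xT.
Qed.

(** At time [1] only the indicator of [s] is left, and its normalization is the barycentre of [s]
    whatever the initial data. *)
Lemma cone_coord1 x m v x' m' : cone_coord x m 1 v = cone_coord x' m' 1 v.
Proof.
rewrite /cone_coord !to_cone1; congr (_ / _).
by apply: eq_bigr => u _; rewrite !to_cone1.
Qed.

(** The parameter space is arbitrary so that the lemma yields both the homotopy of the cube and the
    track of the base point. *)
Lemma cone_map (Q : topologicalType) (x : Q -> X) (m : Q -> V -> R)
    (t : Q -> R) :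
  flag_wrt D s -> continuous x -> (forall v, continuous (m^~ v)) ->
  continuous t -> (forall q, 0 <= t q <= 1) ->
  (forall q, subordinate (x q) (m q)) ->
  exists2 g : Q -> X, continuous g &
    forall q v, g q v = cone_coord (x q) (m q) (t q) v.
Proof.
move=> fl cx cm ct t01 xm.
apply: (@normalized_map Q (T `|` s) (fun q => to_cone (x q) (m q) (t q))).
- by move=> q v; exact: to_cone_ge0.
- by move=> q; exact: to_cone_face.
- by move=> q; exact: to_cone_supported.
- by move=> q; exact: to_cone_gt0.
move=> v; rewrite /to_cone => q.
have c2t : {for q, continuous (fun q => 2 * t q)}.
  by apply: cvgM; [exact: cvg_cst|exact: ct].
have cc : {for q, continuous (fun q => Num.max 0 (2 * t q - 1))}.
  by apply: cvg_max0; apply: cvgB => //; exact: cvg_cst.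
have ca : {for q, continuous (fun q => Num.max 0 (1 - 2 * t q))}.
  by apply: cvg_max0; apply: cvgB => //; exact: cvg_cst.
have cb : {for q, continuous (fun q => 1 - `|2 * t q - 1|)}.
  apply: cvgB; first exact: cvg_cst.
  by apply: cvg_norm; apply: cvgB => //; exact: cvg_cst.
apply: cvgD; first apply: cvgD.
- apply: cvgM => //.
  apply: (@continuous_comp _ _ _ x (fun y : X => y v)); first exact: cx.
  exact: coord_realization_continuous.
- apply: cvg_max0.
  by apply: cvgB => //; apply: cvgM => //; exact: cm.
- apply: cvgM; first exact: cvg_cst.
  apply: cvg_max0.
  apply: cvgB => //; apply: cvgM => //.
  by apply: sum_continuous => u _; exact: cm.
Qed.

End StraightToCone.

(** * Covering the cube by shifted grids of bricks *)

Section Bricks.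
Local Open Scope classical_set_scope.
Local Open Scope ring_scope.
Variables (R : realType) (i n : nat).
Implicit Types (a : 'I_i.+1) (c : {ffun 'I_i -> 'I_n.+1}) (p q : 'rV[R]_i).

(** Coordinates in which the bricks of family [a] are unit cubes with integer corners; the families
    differ by a diagonal translation. *)
Definition shifted a p (j : 'I_i) : R := n%:R * p ord0 j + a%:R / i.+1%:R.

Definition brick a c p : R :=
  \prod_(j < i) Num.max 0 (Num.min (shifted a p j - (c j)%:R)
                                   ((c j)%:R + 1 - shifted a p j)).

Lemma brick_ge0 a c p : 0 <= brick a c p.
Proof. by apply: prodr_ge0 => j _; rewrite le_max lexx. Qed.

Lemma brick_gt0P a c p :
  0 < brick a c p <->
  forall j, (c j)%:R < shifted a p j < (c j)%:R + 1.
Proof.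
split=> [b0 j|cp]; last first.
  apply: prodr_gt0 => j _; have /andP[c1 c2] := cp j.
  by rewrite lt_max lt_min !subr_gt0 c1 c2 orbT.
have : Num.max 0 (Num.min (shifted a p j - (c j)%:R)
    ((c j)%:R + 1 - shifted a p j)) != 0.
  apply: contraTneq b0 => bj0.
  by rewrite /brick (bigD1 j)//= bj0 mul0r ltxx.
apply: contraNT => jNc; apply/eqP/max_l.
by rewrite leNgt lt_min !subr_gt0.
Qed.

(** Open unit intervals with integer ends coincide as soon as they meet. Hence a point lies in at
    most one brick per family, which bounds the number of labels used there by [i.+1]. *)
Lemma brick_inj a c c' p : 0 < brick a c p -> 0 < brick a c' p -> c = c'.
Proof.
move=> /brick_gt0P cp /brick_gt0P c'p; apply/ffunP => j; apply/val_inj => /=.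
have /andP[c1 c2] := cp j; have /andP[c'1 c'2] := c'p j.
have := lt_trans c1 c'2; have := lt_trans c'1 c2.
by rewrite !natr1 !ltr_nat !ltnS => h1 h2; apply/eqP; rewrite eqn_leq h1 h2.
Qed.

Lemma brick_close a c p q j : (0 < n)%N ->
  0 < brick a c p -> 0 < brick a c q -> `|p ord0 j - q ord0 j| < n%:R^-1.
Proof.
move=> n0 /brick_gt0P/(_ j) + /brick_gt0P/(_ j); rewrite /shifted => cp cq.
rewrite -[ltRHS]mul1r ltr_pdivlMr ?ltr0n// mulrC -[X in X * _]ger0_norm//.
rewrite -normrM mulrBr ltr_norml; move: cp cq; set A := _ / _; set x := _ * _.
by set y := _ * q _ _; set z := _%:R => /andP[? ?] /andP[? ?]; lra.
Qed.

(* The [i.+1] shifts of a number by multiples of [1 / i.+1] are distinct modulo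
   1, so each of the [i] coordinates lies on a wall for at most one [a]. *)
Lemma brick_cover p : cube p -> exists a c, 0 < brick a c p.
Proof.
move=> p01.
have sh a j : 0 <= shifted a p j < n.+1%:R.
  rewrite /shifted; have /andP[p0 p1] := p01 j.
  apply/andP; split; first by rewrite addr_ge0 ?mulr_ge0 ?invr_ge0.
  rewrite -[in ltRHS]natr1 ler_ltD//.
    by rewrite -[leRHS]mulr1 ler_wpM2l.
  by rewrite ltr_pdivrMr ?ltr0n// mul1r ltr_nat.
apply: contrapT => nocover.
(* If no coordinate were an integer, the integer parts would index a brick around [p]; they are at
   most [n] by [sh]. *)
have wall a : exists j : 'I_i, exists z : nat, shifted a p j == z%:R.
  apply: contrapT => nowall; apply: nocover; exists a.
  exists [ffun j => inord (Num.truncn (shifted a p j))].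
  apply/brick_gt0P => j; have /andP[s0 sn] := sh a j.
  have /andP[t1 t2] := truncn_itv s0.
  rewrite ffunE inordK; last by rewrite -(ltr_nat R) (le_lt_trans t1).
  rewrite natr1 t2 andbT lt_neqAle t1 andbT; apply/negP => /eqP e.
  by apply: nowall; exists j, (Num.truncn (shifted a p j)); rewrite e.
pose g a := sval (cid (wall a)).
have gP a : exists z : nat, shifted a p (g a) == z%:R.
  exact: svalP (cid (wall a)).
(* Pigeonhole: [i.+1] families but only [i] coordinates. *)
have /injectivePn[a [b ab gab]] : ~~ injectiveb g.
  apply/negP => /injectiveP/leq_card; by rewrite !card_ord ltnn.
have [z /eqP za] := gP a; have [z' /eqP zb] := gP b.
move: zb; rewrite -gab => zb; case/negP: ab; apply/eqP/val_inj => /=.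
have : (a + z' * i.+1 = b + z * i.+1)%N.
  apply/eqP; rewrite -(eqr_nat R) !natrD !natrM -za -zb /shifted !mulrDl.
  by rewrite !divfK ?pnatr_eq0//; apply/eqP; ring.
by move/(congr1 (modn^~ i.+1)); rewrite ![(_ + _ * _)%N]addnC !modnMDl !modn_small.
Qed.

Lemma brick_continuous a c : continuous (brick a c).
Proof.
apply: continuous_big; first exact: mul_continuous.
move=> j _.
have cs : continuous (fun p => shifted a p j).
  rewrite /shifted => q; apply: (@cvgD _ _ _ (nbhs q)); last exact: cvg_cst.
  apply: cvgM; first exact: cvg_cst.
  exact: coord_continuous.
apply: max_fun_continuous; first exact: cst_continuous.
apply: min_fun_continuous => p.
  by apply: (@cvgB _ _ _ (nbhs p)); [exact: cs|exact: cvg_cst].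
by apply: (@cvgB _ _ _ (nbhs p)); [exact: cvg_cst|exact: cs].
Qed.

End Bricks.

(** * Counting the vertices of [s] not joinable to given labels *)

Section CommonNeighbour.
Local Open Scope fset_scope.
Local Open Scope nat_scope.
Variables (V : choiceType) (D : simplicial_complex V).

Lemma cardfs_bigcup (A : Type) (r : seq A) (B : A -> {fset V}) k :
  (forall a, #|` B a| <= k) -> #|` \bigcup_(a <- r) B a| <= size r * k.
Proof.
move=> Bk; elim: r => [|a r IHr]; first by rewrite big_nil cardfs0.
by rewrite big_cons /= mulSn cardfsU (leq_trans (leq_subr _ _))// leq_add.
Qed.

(** Each label excludes at most [(l + 1) - (l - k + 1) = k] vertices of [s], so all labels together
    exclude at most [l] of its [l + 1] vertices. *)
Lemma common_neighbour (k l : nat) (s : {fset V}) (A : finType) (v : A -> V) :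
  simplex D l s ->
  (forall v : V, vertex D v ->
    exists t : {fset V},
      face_of_dim (l%:Z - k%:Z)%R t s /\ joinable D [fset v] t) ->
  (forall a, vertex D (v a)) -> #|A| * k <= l ->
  exists2 w, w \in s & forall a, joinable D [fset v a] [fset w].
Proof.
move=> [_ sl] sk vD Akl.
pose B a := [fset w in s | ~~ `[< joinable D [fset v a] [fset w] >]].
have Bk a : #|` B a| <= k.
  (* The index [a] shows that [A] is nonempty, hence [k <= l] and the faces have nonnegative
     dimension. *)
  have kl : k <= l by apply: leq_trans Akl; rewrite leq_pmull//; apply/card_gt0P; exists a.
  have [t [[ts]]] := sk _ (vD a); rewrite subr_ge0 lez_nat kl => tE.
  move=> [r [Dr vr tr]].
  have tk : #|` t| = (l - k).+1.
    by apply/eqP; rewrite -eqz_nat tE -addn1 PoszD -subzn.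
  have : B a `<=` s `\` t.
    apply/fsubsetP => w; rewrite !inE/= => /andP[ws /asboolPn nj].
    rewrite ws andbT; apply/negP => wt; apply: nj; exists r; split => //.
    by rewrite fsub1set (fsubsetP tr).
  move=> /fsubset_leq_card/leq_trans; apply.
  by rewrite cardfsD (fsetIidPr ts) sl tk subSS subKn.
have : ~~ (s `<=` \bigcup_(a <- enum A) B a).
  apply/negP => /fsubset_leq_card; rewrite leqNgt => /negP; apply.
  by rewrite sl ltnS (leq_trans (cardfs_bigcup _ Bk))// -cardE.
move=> /fsubsetPn[w ws wB]; exists w => // a.
apply/asboolP; apply: contraNT wB => nj; apply/bigfcupP; exists a.
  by rewrite mem_enum.
by rewrite !inE ws.
Qed.

End CommonNeighbour.

(** * Retraction onto the cube and a Lebesgue number *)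

Section CubeMaps.
Local Open Scope classical_set_scope.
Local Open Scope ring_scope.
Variables (R : realType) (i : nat).
Implicit Types p q : 'rV[R]_i.

Lemma rV_continuous (Q : topologicalType) (g : Q -> 'rV[R]_i) :
  (forall j, continuous (fun z => g z ord0 j)) -> continuous g.
Proof.
move=> cg z A [B /= Bz BA].
suff : \forall y \near z, forall j, B ord0 j (g y ord0 j).
  by apply: filterS => y By; apply: BA => a j; rewrite [a]ord1.
by apply: filter_forall => j; exact: (cg j z _ (Bz ord0 j)).
Qed.

(** Precomposing with this retraction turns continuity within the cube into global continuity, so
    later constructions avoid subspace topologies. *)
Definition clamp (x : R) : R := Num.max 0 (Num.min x 1).

Lemma clamp_continuous : continuous clamp.
Proof.
apply: max_fun_continuous; first exact: cst_continuous.
by apply: min_fun_continuous => x; [exact: cvg_id|exact: cst_continuous].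
Qed.

Lemma clamp_itv x : 0 <= clamp x <= 1.
Proof. by rewrite /clamp le_max lexx ge_max ler01 ge_min lexx orbT. Qed.

Lemma clamp_id x : 0 <= x <= 1 -> clamp x = x.
Proof. by case/andP=> x0 x1; rewrite /clamp min_l// max_r. Qed.

Definition clamp_cube p : 'rV[R]_i := \row_j clamp (p ord0 j).

Lemma clamp_cube_continuous : continuous clamp_cube.
Proof.
apply: rV_continuous => j.
rewrite (_ : (fun q => _) = clamp \o (fun q : 'rV[R]_i => q ord0 j)).
  move=> q; apply: continuous_comp; last exact: clamp_continuous.
  exact: coord_continuous.
by apply/funext => q; rewrite /= mxE.
Qed.

Lemma clamp_cubeP p : cube (clamp_cube p).
Proof. by move=> j; rewrite mxE; exact: clamp_itv. Qed.

Lemma clamp_cube_id p : cube p -> clamp_cube p = p.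
Proof. by move=> p01; apply/rowP => j; rewrite mxE clamp_id. Qed.

Lemma cube_compact : compact (@cube R i).
Proof.
rewrite (_ : cube (R := R) (i := i) = [set p : 'rV[R]_i |
    forall j, `[0, 1]%classic (p ord0 j)]).
  apply: (@rV_compact R i (fun=> `[0, 1]%classic)) => j.
  exact: segment_compact.
by apply/seteqP; split => p p01 j; have := p01 j; rewrite /= in_itv.
Qed.

Lemma within_cube_continuous (X : topologicalType) (f : 'rV[R]_i -> X) :
  {within @cube R i, continuous f} -> continuous (f \o clamp_cube).
Proof.
move=> /subspace_continuousP cf p A /(cf _ (clamp_cubeP p)) nA.
have nA' : \forall q \near clamp_cube p, cube q -> A (f q) by [].
have : \forall q \near p, cube (clamp_cube q) -> A (f (clamp_cube q)).
  exact: clamp_cube_continuous nA'.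
by apply: filterS => q; apply; exact: clamp_cubeP.
Qed.

Variables (V : choiceType) (D : simplicial_complex V).
Local Notation X := (realization R D).

(** A Lebesgue number for the open cover by the sets where [f_v] is positive, with the vertex
    prescribed at boundary points. Compactness reduces the claim to a local one. *)
Lemma lebesgue_vertex (f : 'rV[R]_i -> X) (x0 : X) (v0 : V) :
  continuous f -> 0 < x0 v0 -> (forall p, cube_boundary p -> f p = x0) ->
  exists n : nat, forall p, cube p -> exists v,
    (cube_boundary p -> v = v0) /\
    forall q, (forall j, `|p ord0 j - q ord0 j| < n.+1%:R^-1) -> 0 < f q v.
Proof.
move=> cf x0v0 fb.
pose P (n : nat) p := exists v, (cube_boundary p -> v = v0) /\
    forall q, (forall j, `|p ord0 j - q ord0 j| < n.+1%:R^-1) -> 0 < f q v.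
have cfv v : continuous (fun p => f p v).
  move=> p; apply: (@continuous_comp _ _ _ f (fun x : X => x v)).
    exact: cf.
  exact: coord_realization_continuous.
suff : \forall n \near \oo, @cube R i `<=` P n.
  by case=> N _ PN; exists N; exact: (PN N (leqnn N)).
apply: (proj1 (compact_near_coveringP _) cube_compact) => p cp.
(* Take [v0] if it is positive at [p]. Otherwise [f_v0] stays below [x0 v0] near [p], so no boundary
   point is near and any positive vertex will do. *)
have [v [fv vb]] : exists v, 0 < f p v /\
    \forall p' \near p, cube_boundary p' -> v = v0.
  have [v0p|v0p] := ltP 0 (f p v0); first by exists v0; split => //; near=> p'.
  have [v vp] := realization_gt0 (f p); exists v; split => //.
  have : \forall p' \near p, f p' v0 < x0 v0.
    by have /cvgr_lt := cfv v0 p; apply; exact: le_lt_trans v0p _.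
  by apply: filterS => p' + p'b; rewrite fb// ltxx.
have /nbhs_ballP[e /= e0 eP] : \forall q \near p, 0 < f q v.
  by have /cvgr_gt := cfv v p; apply.
(* One half for the distance from [p] to [p'], the other for that from [p'] to [q]. *)
have e20 : 0 < e / 2 by rewrite divr_gt0.
have pe : \forall p' \near p, ball p (e / 2) p' by exact: nbhsx_ballx.
near=> p' n => /=; exists v; split.
  by near: p'.
move=> q p'q; apply: eP; split=> // a j; rewrite [a]ord1.
have pp' : ball p (e / 2) p' by near: p'.
apply: (@ball_splitl _ _ (p' ord0 j)); first exact: pp'.2.
rewrite /ball/= distrC; apply: lt_trans (p'q j) _.
by near: n; exact: (near_infty_natSinv_lt (PosNum e20)).
Unshelve. all: by end_near. Qed.

End CubeMaps.

(** * The map [m] built from labelled bricks *)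

Section SubordinateMap.
Local Open Scope classical_set_scope.
Local Open Scope fset_scope.
Local Open Scope ring_scope.
Variables (R : realType) (V : choiceType) (D : simplicial_complex V).
Local Notation X := (realization R D).
Variables (k l : nat) (s : {fset V}).
Hypothesis sl : simplex D l s.
Hypothesis sk : forall v : V, vertex D v ->
  exists t : {fset V},
    face_of_dim (l%:Z - k%:Z) t s /\ joinable D [fset v] t.

Lemma vertex_gt0 (x : X) v : 0 < x v -> vertex D v.
Proof.
move=> xv; have [Dx cx _] := carrierP x; apply: faces_sub Dx.
by rewrite fsub1set; apply: contraTT xv => /cx ->; rewrite ltxx.
Qed.

(** The case of a single label, used for the track of the base point. *)
Lemma vertex_map_subordinate (T : {fset V}) (x : X) v : (k <= l)%N ->
  supported_on T x -> 0 < x v -> subordinate D s T x (fun u => (u == v)%:R).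
Proof.
move=> kl xT xv; split=> //.
- by move=> u; rewrite pnatr_eq0 eqb0 negbK => /eqP ->; rewrite gt_eqF.
- by exists v; rewrite eqxx.
have [w ws vw] := common_neighbour (A := unit) (v := fun=> v) sl sk
  (fun=> vertex_gt0 xv) ltac:(by rewrite card_unit mul1n).
exists w => // u; rewrite pnatr_eq0 eqb0 negbK => /eqP ->; exact: vw tt.
Qed.

Lemma subordinate_map (i : nat) (f : 'rV[R]_i -> X) (x0 : X) (v0 : V)
    (T : {fset V}) : (i.+1 * k <= l)%N ->
  continuous f -> (forall p, cube p -> supported_on T (f p)) ->
  0 < x0 v0 -> (forall p, cube_boundary p -> f p = x0) ->
  exists m : 'rV[R]_i -> V -> R,
    [/\ forall v, continuous (fun p => m (clamp_cube p) v),
        forall p, cube p -> subordinate D s T (f p) (m p) &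
        forall p v, cube_boundary p -> m p v = (v == v0)%:R].
Proof.
move=> ikl cf fT x0v0 fb; have [n nP] := lebesgue_vertex cf x0v0 fb.
(* The grids have scale [n.+1], so that bricks have side [n.+1%:R^-1], the Lebesgue number. *)
pose I := ('I_i.+1 * {ffun 'I_i -> 'I_n.+2})%type.
pose br (ac : I) (p : 'rV[R]_i) := brick ac.1 ac.2 p.
have br0 ac p : 0 <= br ac p by exact: brick_ge0.
have close ac p q : 0 < br ac p -> 0 < br ac q ->
    forall j, `|p ord0 j - q ord0 j| < n.+1%:R^-1.
  by move=> bp bq j; exact: (brick_close j _ bp bq).
(* A brick meeting the boundary takes its label from one of its boundary points, which forces [v0];
   a brick missing the cube gets [v0] by default. *)
have /choice[h hP] (ac : I) : exists v, forall q, cube q -> 0 < br ac q ->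
    0 < f q v /\ (cube_boundary q -> v = v0).
  have [[p [pb bp]]|nb] := pselect (exists p, cube_boundary p /\ 0 < br ac p).
    have [v [vv0 fv]] := nP p pb.1; exists v => q cq bq.
    by split=> [|_]; [apply: fv; exact: (close ac)|exact: vv0].
  have [[p [cp bp]]|nc] := pselect (exists p, cube p /\ 0 < br ac p).
    have [v [_ fv]] := nP p cp; exists v => q cq bq.
    split=> [|qb]; first by apply: fv; exact: (close ac).
    by case: nb; exists q.
  by exists v0 => q cq bq; case: nc; exists q.
pose S p := \sum_(ac : I) br ac p.
have cover p : cube p -> exists ac, 0 < br ac p.
  by move=> /brick_cover-/(_ n.+1)[a [c]]; exists (a, c).
have S0 p : cube p -> 0 < S p.
  move=> /cover[ac bac]; rewrite /S (bigD1 ac)//= ltr_wpDr//.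
  by apply: sumr_ge0.
have cS : continuous S.
  by apply: sum_continuous => ac _; exact: brick_continuous.
pose m p v := (\sum_(ac | h ac == v) br ac p) / S p.
have mP p v : cube p -> m p v != 0 -> exists2 ac, h ac = v & 0 < br ac p.
  move=> cp mv; apply: contrapT => nac; case/negP: mv; rewrite /m big1 ?mul0r//.
  move=> ac /eqP hac; apply/eqP; rewrite eq_le br0 andbT leNgt; apply/negP.
  by move=> bac; apply: nac; exists ac.
have m0 p v : cube p -> 0 <= m p v.
  by move=> cp; apply: divr_ge0; [apply: sumr_ge0|exact: ltW (S0 p cp)].
exists m; split.
- move=> v.
  (* The denominator [S] is known to be positive only on the cube, hence the clamping. *)
  have cnum : continuous (fun p => \sum_(ac | h ac == v) br ac (clamp_cube p)).
    apply: sum_continuous => ac _ q.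
    apply: (@continuous_comp _ _ _ (@clamp_cube R i) (br ac)).
      exact: clamp_cube_continuous.
    exact: brick_continuous.
  have cden : continuous (fun p => S (clamp_cube p)).
    move=> q; apply: (@continuous_comp _ _ _ (@clamp_cube R i) S).
      exact: clamp_cube_continuous.
    exact: cS.
  move=> p; apply: (@cvgM _ _ (nbhs p)); first exact: cnum.
  apply: (@cvgV _ _ (nbhs p)); last exact: cden.
  by rewrite gt_eqF// S0//; exact: clamp_cubeP.
- move=> p cp; split; first exact: fT.
  + by move=> v; exact: m0.
  + by move=> v /(mP _ _ cp)[ac <- /hP-/(_ cp)[fv _]]; rewrite gt_eqF.
  + have [ac bac] := cover p cp; exists (h ac).
    rewrite divr_gt0 ?S0// (bigD1 ac)//= ltr_wpDr//.
    by apply: sumr_ge0.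
  (* The label of the only brick of family [a] containing [p]. The default [v0] is a vertex too, so
     the count applies to all [i.+1] families. *)
  pose ve a := if pselect (exists c, 0 < br (a, c) p) is left e
    then h (a, sval (cid e)) else v0.
  have vea a c : 0 < br (a, c) p -> ve a = h (a, c).
    move=> bac; rewrite /ve; case: pselect => [e|[]]; last by exists c.
    by congr (h (a, _)); apply: (brick_inj _ bac); exact: svalP (cid e).
  have vev a : vertex D (ve a).
    rewrite /ve; case: pselect => [e|_]; last exact: vertex_gt0 x0v0.
    have := svalP (cid e) => /= be.
    by have [/vertex_gt0] := hP _ _ cp be.
  have [w ws wj] := common_neighbour sl sk vev ltac:(by rewrite card_ord).
  exists w => // u /(mP _ _ cp)[[a c] <- bac]; rewrite -(vea _ _ bac); exact: wj.
- move=> p v pb; have cp := pb.1; rewrite /m.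
  have hb ac : 0 < br ac p -> h ac = v0.
    by move=> /hP-/(_ cp)[_]; exact.
  (* At a boundary point every brick that is positive has label [v0], so the numerator at [v0] is
     all of [S p]. *)
  have [->|vv0] := eqVneq v v0.
    rewrite big_mkcond/=; apply: (canLR (mulfK _)); first by rewrite gt_eqF ?S0.
    rewrite mul1r; apply: eq_bigr => ac _; case: ifPn => // hv.
    by apply/eqP; rewrite eq_sym eq_le br0 andbT leNgt; apply: contra hv => /hb ->.
  rewrite big1 ?mul0r// => ac /eqP hv.
  apply/eqP; rewrite eq_le br0 andbT leNgt; apply: contra vv0 => /hb <-.
  by rewrite hv.
Qed.

End SubordinateMap.

(** * Making a free homotopy relative to the boundary *)

Section FreeToBased.
Local Open Scope classical_set_scope.
Local Open Scope ring_scope.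
Variables (R : realType) (i : nat).
Implicit Types p : 'rV[R]_i.

(** On the cube this is the sup-distance to the boundary if [0 < i]; for [i = 0] the boundary is
    empty and the value is [1]. *)
Definition bdist p : R := \big[Num.min/1]_(j < i) Num.min (p ord0 j) (1 - p ord0 j).

Lemma bdist_continuous : continuous bdist.
Proof.
apply: continuous_big; first exact: min_continuous.
move=> j _; apply: min_fun_continuous; first exact: coord_continuous.
move=> p; apply: (@cvgB _ _ _ (nbhs p)); first exact: cvg_cst.
exact: coord_continuous.
Qed.

Lemma bdist_ge0 p : cube p -> 0 <= bdist p.
Proof.
move=> p01; rewrite /bdist; elim/big_ind: _ => // [x y x0 y0|j _].
  by rewrite le_min x0.
by rewrite le_min subr_ge0; exact: p01.
Qed.

Lemma bdist_boundary p : cube_boundary p -> bdist p = 0.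
Proof.
move=> [cp [j pj]]; apply/eqP; rewrite eq_le bdist_ge0// andbT.
rewrite /bdist (bigD1 j)//= ge_min; apply/orP; left.
by rewrite ge_min; case: pj => ->; rewrite ?lexx// subrr lexx orbT.
Qed.

(** The bound [e < 1] excludes the default value [1] of the minimum. *)
Lemma bdist_le p (e : R) : e < 1 -> bdist p <= e ->
  exists j, p ord0 j <= e \/ 1 - p ord0 j <= e.
Proof.
move=> e1; rewrite leNgt => pe; apply: contrapT => nj; case/negP: pe.
rewrite /bdist; elim/big_ind: _ => // [x y xe ye|j _]; first by rewrite lt_min xe.
by rewrite lt_min !ltNge; apply/andP; split; apply/negP => h; apply: nj;
  exists j; [left|right].
Qed.

(* For [t] in [0, 1] this expands the cube about its centre, so that every
   point at distance at most [t / 4] from the boundary lands on the boundary. *)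
Definition expand p (t : R) : 'rV[R]_i :=
  clamp_cube (\row_j ((1 + t) * (p ord0 j - 1 / 2) + 1 / 2)).

Lemma expand0 p : cube p -> expand p 0 = p.
Proof.
move=> cp; rewrite /expand (_ : \row__ _ = p) ?clamp_cube_id//.
by apply/rowP => j; rewrite mxE; ring.
Qed.

Lemma expand_boundary p t : cube p -> 0 <= t <= 1 -> 4 * bdist p <= t ->
  cube_boundary (expand p t).
Proof.
move=> cp /andP[t0 t1] dt; split; first exact: clamp_cubeP.
(* If [p_j <= t / 4], the expanded coordinate is at most [(t ^ 2 - t) / 4 <= 0] and is clamped to
   [0]; the other end is symmetric. *)
have [||j pj] := @bdist_le p (t / 4); [lra|lra|exists j].
have /andP[p0 p1] := cp j; rewrite !mxE; set x := p ord0 j in pj p0 p1 *.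
case: pj => px; [left; apply: max_l|right].
  by rewrite ge_min; apply/orP; left; nra.
by rewrite /clamp min_r ?max_r//; nra.
Qed.

Lemma expand_continuous : continuous (fun z : 'rV[R]_i * R => expand z.1 z.2).
Proof.
move=> z; apply: (@continuous_comp _ _ _ (fun z : 'rV[R]_i * R =>
  \row_j ((1 + z.2) * (z.1 ord0 j - 1 / 2) + 1 / 2)) (@clamp_cube R i)).
  apply: rV_continuous => j {}z.
  rewrite (_ : (fun _ => _) = fun z : 'rV[R]_i * R =>
    (1 + z.2) * (z.1 ord0 j - 1 / 2) + 1 / 2); last first.
    by apply/funext => y; rewrite mxE.
  apply: (@cvgD _ _ _ (nbhs z)); last exact: cvg_cst.
  apply: (@cvgM _ _ (nbhs z)).
    by apply: (@cvgD _ _ _ (nbhs z)); [exact: cvg_cst|exact: cvg_snd].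
  apply: (@cvgB _ _ _ (nbhs z)); last exact: cvg_cst.
  apply: (@continuous_comp _ _ _ fst (fun p : 'rV[R]_i => p ord0 j)).
    exact: cvg_fst.
  exact: coord_continuous.
exact: clamp_cube_continuous.
Qed.

Lemma pair_continuous (Q X Y : topologicalType) (f : Q -> X) (g : Q -> Y) :
  continuous f -> continuous g -> continuous (fun z => (f z, g z)).
Proof. by move=> cf cg z; exact: cvg_pair (cf z) (cg z). Qed.

Lemma continuous_if_le (Q X : topologicalType) (t : Q -> R) (a : R)
    (f g : Q -> X) : continuous t -> continuous f -> continuous g ->
  (forall q, t q = a -> f q = g q) ->
  continuous (fun q => if t q <= a then f q else g q).
Proof.
move=> ct cf cg fg; apply/continuous_subspace_setT.
rewrite (_ : setT = [set q | t q <= a] `|` [set q | a <= t q]); last first.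
  by apply/seteqP; split => // q _; case: (leP (t q) a) => [|/ltW]; [left|right].
apply: withinU_continuous.
- by apply: (@closed_comp _ _ t [set x | x <= a]) => [q _|]; [exact: ct|exact: closed_le].
- by apply: (@closed_comp _ _ t [set x | a <= x]) => [q _|]; [exact: ct|exact: closed_ge].
- apply: subspace_eq_continuous (continuous_subspaceT cf) => q.
  by rewrite inE /from_subspace /= => ->.
- apply: subspace_eq_continuous (continuous_subspaceT cg) => q.
  rewrite inE /from_subspace /= => aq; case: leP => // qa.
  by apply/esym/fg/eqP; rewrite eq_le qa aq.
Qed.

(* The collar of the cube absorbs the track [g] of the base point. *)
Lemma spheroid_nullhomotopic (X : topologicalType) (x0 c : X)
    (f : 'rV[R]_i -> X) (G : 'rV[R]_i * R -> X) (g : R -> X) :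
  continuous G -> continuous g ->
  (forall p, cube p -> G (p, 0) = f p) ->
  (forall p, cube p -> G (p, 1) = c) ->
  (forall p (t : R), cube_boundary p -> 0 <= t <= 1 -> G (p, t) = g t) ->
  g 0 = x0 -> g 1 = c -> spheroid_homotopic x0 f (fun=> x0).
Proof.
move=> cG cg G0 G1 Gb g0 g1.
pose P (z : 'rV[R]_i * R) := clamp_cube z.1.
have cP z : cube (P z) by exact: clamp_cubeP.
(* The first half expands the cube and runs [G], stopping at time [4 * bdist]; points of the collar
   are then already on the boundary and follow [g]. The second half runs [g] back to [g 0 = x0]. *)
pose K z := if z.2 <= 1 / 2
  then G (expand (P z) (clamp (2 * z.2)), Num.min (clamp (2 * z.2)) (4 * bdist (P z)))
  else g (Num.min (2 - 2 * z.2) (4 * bdist (P z))).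
have clampE (x : R) : 0 <= x <= 1 -> clamp x = x by exact: clamp_id.
have d0 z : 0 <= bdist (P z) by exact: bdist_ge0.
have Gg z (t : R) : 0 <= t <= 1 -> 4 * bdist (P z) <= t ->
    G (expand (P z) t, 4 * bdist (P z)) = g (4 * bdist (P z)).
  move=> t01 dt; apply: Gb; first exact: expand_boundary.
  by have := d0 z; lra.
exists K; split.
- apply: continuous_subspaceT.
  have cPz : continuous P.
    move=> z; apply: (@continuous_comp _ _ _ fst (@clamp_cube R i)).
      exact: cvg_fst.
    exact: clamp_cube_continuous.
  have cd : continuous (fun z => 4 * bdist (P z)).
    move=> z; apply: (@cvgM _ _ (nbhs z)); first exact: cvg_cst.
    apply: (@continuous_comp _ _ _ P bdist); first exact: cPz.
    exact: bdist_continuous.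
  have c2 : continuous (fun z : 'rV[R]_i * R => 2 * z.2).
    by move=> z; apply: (@cvgM _ _ (nbhs z)); [exact: cvg_cst|exact: cvg_snd].
  have ccl : continuous (fun z : 'rV[R]_i * R => clamp (2 * z.2)).
    move=> z; apply: (@continuous_comp _ _ _ (fun z : 'rV[R]_i * R => 2 * z.2)
      (@clamp R)); [exact: c2|exact: clamp_continuous].
  have cmin : continuous (fun z : 'rV[R]_i * R =>
      Num.min (clamp (2 * z.2)) (4 * bdist (P z))).
    exact: min_fun_continuous.
  have cexp : continuous (fun z : 'rV[R]_i * R => expand (P z) (clamp (2 * z.2))).
    move=> z; apply: (@continuous_comp _ _ _ (fun z : 'rV[R]_i * R => (P z, clamp (2 * z.2)))
      (fun y => expand y.1 y.2)); last exact: expand_continuous.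
    by apply: pair_continuous.
  apply: continuous_if_le.
  + by move=> z; exact: cvg_snd.
  + move=> z; apply: (@continuous_comp _ _ _ (fun z : 'rV[R]_i * R =>
      (expand (P z) (clamp (2 * z.2)),
       Num.min (clamp (2 * z.2)) (4 * bdist (P z)))) G); last exact: cG.
    by apply: pair_continuous.
  + move=> z; apply: (@continuous_comp _ _ _ (fun z : 'rV[R]_i * R =>
      Num.min (2 - 2 * z.2) (4 * bdist (P z))) g); last exact: cg.
    apply: min_fun_continuous => // y.
    by apply: (@cvgB _ _ _ (nbhs y)); [exact: cvg_cst|exact: c2].
  (* At the seam both formulas give [g (4 * bdist)] in the collar and [c = g 1] outside it. *)
  + move=> z ->; have -> : 2 * (1 / 2) = 1 :> R by lra.
    have -> : 2 - 1 = 1 :> R by lra.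
    rewrite clampE ?ler01 ?lexx//; have [d1|d1] := leP (4 * bdist (P z)) 1.
      by rewrite Gg ?ler01 ?lexx.
    by rewrite G1 ?g1//; exact: clamp_cubeP.
- move=> p cp; rewrite /K /P/= clamp_cube_id// mulr0 clampE ?lexx ?ler01//.
  rewrite divr_ge0// expand0// min_l ?G0//.
  by rewrite mulr_ge0// bdist_ge0.
- move=> p cp; rewrite /K /P/= clamp_cube_id// mulr1 subrr ifF.
    by rewrite min_l// mulr_ge0// bdist_ge0.
  by apply/negbTE; rewrite -ltNge; lra.
- move=> p t pb /andP[t0 t1]; have bp : bdist (P (p, t)) = 0.
    by rewrite /P/= clamp_cube_id ?bdist_boundary//; exact: pb.1.
  rewrite /K /=; case: leP => t2.
    have c01 : 0 <= clamp (2 * t) <= 1 by exact: clamp_itv.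
    have /andP[c0 _] := c01; rewrite bp mulr0 (min_r c0).
    by have := @Gg (p, t) _ c01; rewrite bp mulr0 g0; apply.
  by rewrite bp mulr0 min_r//; lra.
Qed.

End FreeToBased.

(** * Nonemptiness and the final assembly *)

Lemma simplex_realization_nonempty (R : realType) (V : choiceType)
    (D : simplicial_complex V) (l : nat) (s : {fset V}) :
  simplex D l s -> exists x : realization R D, True.
Proof.
case=> Ds sl; have [w ws] : exists w, w \in s.
  by apply/fset0Pn; rewrite -cardfs_gt0 sl.
have ge0 v : 0 <= (v == w)%:R :> R by [].
suff sum1 : exists r : {fset V}, [/\ faces D r,
    supported_on r (fun v => (v == w)%:R : R) & \sum_(v <- r) (v == w)%:R = 1 :> R].
  by exists (Realization ge0 sum1).
exists [fset w]%fset; split.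
- by apply: faces_sub Ds; rewrite fsub1set.
- by move=> v; rewrite inE => /negbTE ->.
- by rewrite big_seq_fset1 eqxx.
Qed.

Theorem lemma5p5 (R : realType) (V : choiceType) (D : simplicial_complex V)
    (k l : nat) (s : {fset V}) :
  (0 < k)%N ->
  simplex D l s ->
  flag_wrt D s ->
  (forall v : V, vertex D v ->
    exists t : {fset V},
      face_of_dim (l%:Z - k%:Z) t s /\ joinable D [fset v]%fset t) ->
  n_connected R (realization R D) ((l %/ k)%N%:Z - 1).
Proof.
move=> k0 sl fl sk; split=> [_|i il x0 f [cf fb]].
  exact: simplex_realization_nonempty sl.
have ikl : (i.+1 * k <= l)%N by rewrite -leq_divRL// -lez_nat; lia.
have kl : (k <= l)%N by apply: leq_trans ikl; rewrite leq_pmull.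
pose F := f \o @clamp_cube R i.
have cF : continuous F by exact: within_cube_continuous.
have Fclamp p : F (clamp_cube p) = F p.
  by rewrite /F/= clamp_cube_id//; exact: clamp_cubeP.
have Fb p : cube_boundary p -> F p = x0.
  by move=> pb; rewrite /F/= clamp_cube_id ?fb//; exact: pb.1.
have [T1 fT1] := compact_supported (@cube_compact R i) cf.
(* The carrier of [x0] is added because for [i = 0] the boundary is empty and [x0] need not be a
   value of [f]. *)
have [_ cx0 _] := carrierP x0; pose T := (T1 `|` carrier x0)%fset.
have FT p : supported_on T (F p).
  move=> v; rewrite inE negb_or => /andP[vT1 _].
  by apply: fT1 vT1; exact: clamp_cubeP.
have x0T : supported_on T x0.
  by move=> v; rewrite inE negb_or => /andP[_]; exact: cx0.
have [v0 x0v0] := realization_gt0 x0.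
have [m [cm mF mb]] := subordinate_map sl sk ikl cF (fun p _ => FT p) x0v0 Fb.
have mx0 := vertex_map_subordinate sl sk kl x0T x0v0.
have [|||||G cG GE] := @cone_map R V D s T ('rV[R]_i * R)%type
  (fun z => F z.1) (fun z => m (clamp_cube z.1)) (fun z => clamp z.2) fl.
- move=> z; apply: (@continuous_comp _ _ _ fst F); first exact: cvg_fst.
  exact: cF.
- move=> v z.
  apply: (@continuous_comp _ _ _ fst (fun p => m (clamp_cube p) v)).
    exact: cvg_fst.
  exact: cm.
- move=> z; apply: (@continuous_comp _ _ _ snd (@clamp R)).
    exact: cvg_snd.
  exact: clamp_continuous.
- by move=> z; exact: clamp_itv.
- by move=> z; rewrite -Fclamp; apply: mF; exact: clamp_cubeP.
(* The track of the base point: the same formula with constant data. It agrees with [G] over the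
   boundary, where [m] is the indicator of [v0], and [g 1] is the barycentre of [s]. *)
have [|||||g cg gE] := @cone_map R V D s T R
  (fun=> x0) (fun=> fun v => (v == v0)%:R) (@clamp R) fl.
- by move=> z; exact: cvg_cst.
- by move=> v z; exact: cvg_cst.
- exact: clamp_continuous.
- by move=> z; exact: clamp_itv.
- by [].
have clamp0 : clamp 0 = 0 :> R by rewrite clamp_id ?lexx ?ler01.
have clamp1 : clamp 1 = 1 :> R by rewrite clamp_id ?lexx ?ler01.
apply: (@spheroid_nullhomotopic R i _ x0 (g 1) f G g cG cg) => //.
- move=> p cp; apply: realization_ext => v.
  rewrite GE /= clamp0 cone_coord0; last first.
    by rewrite -Fclamp; apply: mF; exact: clamp_cubeP.
  by rewrite /F/= clamp_cube_id.
- move=> p cp; apply: realization_ext => v.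
  by rewrite GE gE /= clamp1; exact: cone_coord1.
- move=> p t pb t01; apply: realization_ext => v.
  have mE : m (clamp_cube p) = fun v => (v == v0)%:R.
    by apply/funext => u; rewrite clamp_cube_id ?mb//; exact: pb.1.
  by rewrite GE gE /= mE Fb.
- by apply: realization_ext => v; rewrite gE clamp0 cone_coord0.
Qed.
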